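(* Let $A_\sigma$ be the set of irrational $x\in(0,1)$ such that $g_{m+1}(x)>g_1(x)+\dots+g_m(x)$ for every $m\in\mathbb N$. Then $\lambda(A_\sigma)=0$, where $\lambda$ is Lebesgue measure.
   Context: Every irrational $x\in(0,1)$ has a unique expansion $x=\sum_{n\ge1}\frac{(-1)^{n-1}}{g_1(g_1+g_2)\cdots(g_1+g_2+\dots+g_n)}$ with all $g_n\in\mathbb N=\{1,2,\dots\}$ (the first Ostrogradsky series written in terms of differences $g_1=q_1$, $g_{n+1}=q_{n+1}-q_n$); $g_n=g_n(x)$ is called the $n$-th $\bar O^1$-symbol of $x$. *)

(* Defs.v *)
From HB Require Import structures.
From mathcomp Require Import all_boot all_order all_algebra.
From mathcomp Require Import all_classical all_reals all_analysis.
Set Implicit Arguments.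
Unset Strict Implicit.
Unset Printing Implicit Defensive.
Import Order.TTheory GRing.Theory Num.Theory.
Import numFieldNormedType.Exports.
Local Open Scope classical_set_scope.
Local Open Scope ring_scope.

(* Sequences are indexed from 0: [g k] stands for the symbol g_{k+1}. *)

(* q_{k+1} = g_1 + ... + g_{k+1}. *)
Definition O1_q (g : nat -> nat) (k : nat) : nat := (\sum_(i < k.+1) g i)%N.

(* With n = k + 1, this is (-1)^(n-1) / (g_1 (g_1 + g_2) ... (g_1 + ... + g_n)). *)
Definition O1_term (R : realType) (g : nat -> nat) (k : nat) : R :=
  (-1) ^+ k / \prod_(j < k.+1) (O1_q g j)%:R.

Definition is_O1_expansion (R : realType) (g : nat -> nat) (x : R) : Prop :=
  (forall k, (0 < g k)%N) /\ series (O1_term R g) @ \oo --> x.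

(* [O1_symbol x k] is g_{k+1}(x).  An irrational x in (0, 1) has exactly one
   expansion, so the choice made by [xget] is forced; the default (zero)
   sequence only concerns numbers without an expansion. *)
Definition O1_symbol (R : realType) (x : R) : nat -> nat :=
  xget (fun=> 0%N) [set g | is_O1_expansion g x].

(* The index k corresponds to m = k + 1 >= 1 in
   g_{m+1}(x) > g_1(x) + ... + g_m(x). *)
Definition A_sigma (R : realType) : set R :=
  [set x | [/\ irrational x, 0 < x < 1 &
    forall k, (\sum_(i < k.+1) O1_symbol x i < O1_symbol x k.+1)%N]].

Arguments A_sigma R : clear implicits.

(* Main.v *)
Require Import Defs.
From mathcomp Require Import all_boot all_order all_algebra.
From mathcomp Require Import all_classical all_reals all_analysis.
From mathcomp Require Import measurable_realfun.
From mathcomp Require Import ring lra zify.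
Set Implicit Arguments.
Unset Strict Implicit.
Unset Printing Implicit Defensive.
Import Order.TTheory GRing.Theory Num.Theory.
Import numFieldNormedType.Exports.
Local Open Scope classical_set_scope.
Local Open Scope ring_scope.

(* Let [T a] be the set of sums of [(-1)^k / (q_0 ... q_k)] with [q_0 >= a] and
   [q_(k+1) > 2 q_k], so that [A_sigma] is contained in [T 1].  Such a sum is
   [x = (1 - y) / q_0] with [y] in [T (2 q_0 + 1)]; hence, if
   [lambda (T a) <= C / a] for all [a >= 1], then
   [lambda (T a) <= sum_(q >= a) C / (q (2q + 1))
                 <= (2/3) C sum_(q >= a) 1 / (q (q + 1)) = (2/3) C / a].
   Starting from [T a] in [[0, 1/a]], iteration yields [lambda (T a) = 0]. *)

(** The measure c times the pushforward of Lebesgue measure under x |-> b - c x agrees with Lebesgue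
    measure on half-open intervals, hence everywhere by uniqueness. *)
Lemma lebesgue_measure_preimage_affine (R : realType) (b c : R) (A : set R) :
    0 < c -> measurable A ->
  lebesgue_measure ((fun x => b - c * x) @^-1` A) =
  (c^-1%:E * lebesgue_measure A)%E.
Proof.
move=> c0 mA.
pose f (x : measurableTypeR R) : measurableTypeR R := b - c * (x : R).
have mf : measurable_fun setT f.
  by apply: measurable_funB => //; apply: measurable_funM.
pose nu := mscale (NngNum (ltW c0)) (pushforward (@lebesgue_measure R) f).
suff -> : lebesgue_measure A = nu mf A.
  by rewrite /nu /mscale/= muleA -EFinM mulVf ?gt_eqF// mul1e.
apply: lebesgue_measure_unique => //= _ [[u v]] _ <-.
rewrite /nu /mscale/= /pushforward.
rewrite [f @^-1` _](_ : _ = `[(b - v) / c, (b - u) / c[%classic); last first.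
  apply/seteqP; split=> x; rewrite /f/= !in_itv/= ler_pdivrMr// ltr_pdivlMr//;
  by move=> /andP[? ?]; apply/andP; split; lra.
rewrite !lebesgue_measure_itv/= !lte_fin ltr_pM2r ?invr_gt0// ltrD2l ltrN2.
case: ifP => _; last by rewrite mule0.
rewrite -EFinD -EFinM; congr EFin.
by field; rewrite gt_eqF.
Qed.

Lemma nneseries_telescope_le (R : realType) (c : R) (a : nat) :
    0 <= c -> (0 < a)%N ->
  (\sum_(0 <= i <oo) (c * ((a + i)%:R^-1 - (a + i).+1%:R^-1))%:E <=
   (c / a%:R)%:E)%E.
Proof.
move=> c0 a0; apply: lime_le.
  apply: is_cvg_nneseries => i _ _; rewrite lee_fin mulr_ge0// subr_ge0.
  by rewrite lef_pV2 ?ler_nat// posrE ltr0n//; lia.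
apply: nearW => n; rewrite sumEFin lee_fin -mulr_sumr ler_wpM2l//.
rewrite -[X in X <= _]opprK -sumrN.
under eq_bigr do rewrite opprB -addnS.
rewrite telescope_sumr// opprB addn0.
by rewrite lerBlDr lerDl invr_ge0 ler0n.
Qed.

Section alternating_products.
Variable R : realType.

(** The data are the partial sums q_k rather than the symbols: the tail of the series is then
    governed by the plain shift [q \o succn], whereas dropping g_1 would change every partial
    sum. *)
Definition alt_term (q : nat -> nat) (k : nat) : R :=
  (-1) ^+ k / \prod_(j < k.+1) (q j)%:R.

Lemma series_alt_termS (q : nat -> nat) (n : nat) :
  series (alt_term q) n.+1 =
  (q 0)%:R^-1 * (1 - series (alt_term (q \o succn)) n).
Proof.
rewrite /series/= big_nat_recl// {1}/alt_term expr0 big_ord_recl big_ord0 mulr1.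
rewrite mulrBr mulr1 mul1r; congr (_ + _).
rewrite mulr_sumr -sumrN; apply: eq_bigr => k _.
by rewrite /alt_term big_ord_recl/= exprS invfM; ring.
Qed.

(** Induction on n for all q at once: the shifted partial sum lies in [0, 1/q_1], hence in [0, 1],
    and so does 1 minus it, which is then divided by q_0. *)
Lemma series_alt_term_bounds (q : nat -> nat) (n : nat) :
    (forall k, 0 < q k)%N ->
  0 <= series (alt_term q) n <= (q 0)%:R^-1.
Proof.
elim: n q => [|n IHn] q q0.
  by rewrite /series/= big_geq// lexx invr_ge0 ler0n.
have /andP[s0 s1] := IHn (q \o succn) (fun k => q0 k.+1).
have s1' : series (alt_term (q \o succn)) n <= 1.
  by apply: (le_trans s1); rewrite /= invf_le1 ?ltr0n// ler1n.
rewrite series_alt_termS mulr_ge0 ?invr_ge0 ?ler0n ?subr_ge0//=.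
by rewrite ler_piMr ?invr_ge0 ?ler0n// gerBl.
Qed.

Definition doubling_sums (a : nat) : set R :=
  [set x | exists q : nat -> nat, [/\ (a <= q 0)%N,
    forall k, (2 * q k < q k.+1)%N & series (alt_term q) @ \oo --> x]].

Lemma doubling_sums_subset_itv (a : nat) : (0 < a)%N ->
  doubling_sums a `<=` `[0, a%:R^-1].
Proof.
move=> a0 x [q [aq q2 qx]].
have q0 k : (0 < q k)%N by elim: k => [|k IHk]; [|have := q2 k]; lia.
have sb n := series_alt_term_bounds n q0.
have qa : (q 0)%:R^-1 <= a%:R^-1 :> R.
  by rewrite lef_pV2 ?posrE ?ltr0n// ler_nat.
have cs : cvgn (series (alt_term q)) by apply/cvg_ex; exists x.
rewrite /= in_itv/= -(cvg_lim (@Rhausdorff R) qx); apply/andP; split.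
  by apply: limr_ge => //; apply: nearW => n; case/andP: (sb n).
apply: limr_le => //; apply: nearW => n.
by case/andP: (sb n) => _ /le_trans; apply.
Qed.

Lemma doubling_sums_subset_preimage (a : nat) : (0 < a)%N ->
  doubling_sums a `<=`
  \bigcup_i ((fun x => 1 - (a + i)%:R * x) @^-1`
             doubling_sums (2 * (a + i)).+1).
Proof.
(* The index i = q_0 - a makes a + i equal to q_0. *)
move=> a0 x [q [aq q2 qx]]; exists (q 0%N - a)%N => //=.
rewrite subnKC//; exists (q \o succn); split => //=.
have q0 : (q 0)%:R != 0 :> R by rewrite pnatr_eq0 -lt0n (leq_trans a0).
(* Solving the recursion for the tail gives its convergence, with limit 1 - q_0 x, from that of the
   full series. *)
have -> : series (alt_term (q \o succn)) =
          (fun n => 1 - (q 0)%:R * series (alt_term q) n.+1).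
  apply/funext => n.
  by rewrite series_alt_termS mulrA divff// mul1r opprB addrC subrK.
apply: cvgB; first exact: cvg_cst.
apply: cvgM; first exact: cvg_cst.
by rewrite cvg_shiftS.
Qed.

(* Measurable supersets of [doubling_sums a], since the affine change of
   variable is only available on measurable sets. *)
Fixpoint hull (n a : nat) : set R :=
  if n is n'.+1 then
    \bigcup_i ((fun x => 1 - (a + i)%:R * x) @^-1` hull n' (2 * (a + i)).+1)
  else `[0, a%:R^-1]%classic.

Lemma doubling_sums_subset_hull (n a : nat) : (0 < a)%N ->
  doubling_sums a `<=` hull n a.
Proof.
elim: n a => [|n IHn] a a0; first exact: doubling_sums_subset_itv.
apply: (subset_trans (doubling_sums_subset_preimage a0)).
by apply: subset_bigcup => i _; apply: preimage_subset; apply: IHn.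
Qed.

Lemma measurable_hull_preimage (n a i : nat) : measurable (hull n a) ->
  measurable ((fun x : R => 1 - i%:R * x) @^-1` hull n a).
Proof.
move=> mh; rewrite -[X in measurable X]setTI.
have mf : measurable_fun (setT : set R) (fun x : R => 1 - i%:R * x).
  by apply: measurable_funB => //; apply: measurable_funM.
exact: mf.
Qed.

Lemma measurable_hull (n a : nat) : measurable (hull n a).
Proof.
elim: n a => [|n IHn] a; first exact: measurable_itv.
by apply: bigcupT_measurable => i; apply: measurable_hull_preimage.
Qed.

Lemma lebesgue_measure_hull (n a : nat) : (0 < a)%N ->
  (lebesgue_measure (hull n a) <= ((2 / 3) ^+ n / a%:R)%:E)%E.
Proof.
elim: n a => [|n IHn] a a0.
  rewrite lebesgue_measure_itv/= lte_fin invr_gt0 ltr0n a0.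
  by rewrite -EFinD lee_fin subr0 expr0 mul1r.
have mh := measurable_hull.
apply: (le_trans (measure_sigma_subadditive (@lebesgue_measure R)
  (fun i => measurable_hull_preimage (a + i) (mh n (2 * (a + i)).+1))
  (mh n.+1 a) (@subset_refl _ _))).
apply: le_trans (nneseries_telescope_le _ a0); last by apply: exprn_ge0; lra.
apply: lee_nneseries => // i _.
have m0 : 0 < (a + i)%:R :> R by rewrite ltr0n; lia.
have m1 : 1 <= (a + i)%:R :> R by rewrite ler1n; lia.
rewrite [leLHS](lebesgue_measure_preimage_affine 1 m0)//.
apply: (@le_trans _ _ ((a + i)%:R^-1%:E *
    ((2 / 3) ^+ n / (2 * (a + i)).+1%:R)%:E)%E).
  by apply: lee_pmul => //; apply: IHn.
rewrite -EFinM lee_fin exprSr.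
have -> : (2 * (a + i)).+1%:R = 2 * (a + i)%:R + 1 :> R by rewrite -natr1 natrM.
rewrite -[(a + i).+1%:R]natr1; set m := (a + i)%:R in m0 m1 *.
have -> : m^-1 * ((2 / 3) ^+ n / (2 * m + 1)) =
          (2 / 3) ^+ n * (m^-1 / (2 * m + 1)) by ring.
rewrite -mulrA ler_wpM2l//.
(* What remains is 1/(2m + 1) <= 2/(3(m + 1)), that is m >= 1; equality at m = 1 fixes the constant
   2/3. *)
have -> : 2 / 3 * (m^-1 - (m + 1)^-1) = m^-1 * (2 / (3 * (m + 1))).
  by field; rewrite !gt_eqF//; lra.
rewrite ler_wpM2l ?invr_ge0 ?(ltW m0)//.
rewrite ler_pdivlMr; last lra.
rewrite [leLHS]mulrC ler_pdivrMr; lra.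
Qed.

(** Every [hull n a] contains the set and their measures tend to 0, so their intersection is a
    measurable null cover. *)
Lemma doubling_sums_negligible (a : nat) : (0 < a)%N ->
  (@lebesgue_measure R).-negligible (doubling_sums a).
Proof.
move=> a0; have mh n := measurable_hull n a.
have mI : measurable (\bigcap_n hull n a) by exact: bigcapT_measurable.
exists (\bigcap_n hull n a); split => //; last first.
  by move=> x Tx n _; exact: doubling_sums_subset_hull.
have le0 n : (lebesgue_measure (\bigcap_n hull n a) <=
    ((2 / 3) ^+ n / a%:R)%:E)%E.
  apply: le_trans (lebesgue_measure_hull n a0).
  apply: le_measure; [exact/mem_set|exact: (mem_set (mh n))|].
  exact: bigcap_inf.
apply/eqP; rewrite eq_le measure_ge0 andbT.
have cv : (((2 / 3) ^+ n / a%:R)%:E @[n --> \oo] --> (0 : R)%:E)%E.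
  apply: cvg_EFin; first exact: nearW.
  rewrite -(mul0r (a%:R^-1)); apply: cvgM; last exact: cvg_cst.
  by apply: cvg_expr; rewrite ger0_norm; lra.
rewrite -[leRHS](cvg_lim _ cv)//; apply: lime_ge.
  by apply/cvg_ex; eexists; exact: cv.
exact: nearW.
Qed.

Lemma A_sigma_subset_doubling_sums : A_sigma R `<=` doubling_sums 1.
Proof.
move=> x [_ _]; rewrite /O1_symbol.
(* Without an expansion the symbols would be the default 0, and 0 < 0 fails. *)
case: xgetP => [g _ [g0 gx] gsum|_ /(_ 0%N)]; last by [].
(* [O1_term R g] is [alt_term R (O1_q g)] by conversion, so [gx] is already the required
   convergence. *)
exists (O1_q g); split => // [|k].
  by rewrite /O1_q big_ord_recl big_ord0 addn0.
(* Since the next partial sum is the current one plus the next symbol, doubling is exactly the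
   condition [gsum]. *)
by rewrite /O1_q [ltnRHS]big_ord_recr/= mul2n -addnn ltn_add2l; exact: gsum.
Qed.

End alternating_products.

(* [lebesgue_measure] is, on arbitrary sets, the Lebesgue outer measure; its
   vanishing says exactly that the set is Lebesgue measurable and null. *)
Theorem theorem2 (R : realType) : lebesgue_measure (A_sigma R) = 0%E.
Proof.
apply/negligible_outer_measure.
have [B [mB B0 TB]] := @doubling_sums_negligible R 1 isT.
exists B; split => //.
exact: subset_trans (@A_sigma_subset_doubling_sums R) TB.
Qed.
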